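(* Let $(X,\mathcal D)$ be a multimetric space (endowed with its canonical topology) and let $\mathcal F$ be a function system on $X$ which is Edelstein contracting with respect to $\mathcal D$. Then the following conditions are equivalent: (1) $\mathcal F$ is topologically contracting; (2) $\mathcal F$ is compactly contracting; (3) $\mathcal F$ is locally contracting; (4) $\mathcal F$ has an attractor; (5) $\mathcal F$ is compact-dominating.
   Context: All spaces are non-empty. $\omega=\{0,1,2,\dots\}$. A multimetric on a set $X$ is a family $\mathcal D$ of pseudometrics on $X$ such that for any distinct $x,y\in X$ there is $d\in\mathcal D$ with $d(x,y)>0$; $(X,\mathcal D)$ is then called a multimetric space. Its canonical topology is the smallest topology on $X$ in which all $d\in\mathcal D$ are continuous: $U\subset X$ is open iff for every $x\in U$ there are $\varepsilon>0$ and a finite $\mathcal E\subset\mathcal D$ with $\bigcap_{d\in\mathcal E}\{y:d(x,y)<\varepsilon\}\subset U$. A function system on a topological space $X$ is a non-empty finite family $\mathcal F$ of continuous maps $X\to X$. Put $\mathcal F^0=\{\mathrm{id}_X\}$, $\mathcal F^{n+1}=\{f\circ g: f\in\mathcal F,\ g\in\mathcal F^n\}$, $\mathcal F^{\ge k}=\bigcup_{n\ge k}\mathcal F^n$, and $\mathcal F(A)=\bigcup_{f\in\mathcal F}f(A)$ for $A\subset X$. $\mathcal K(X)$ is the space of non-empty compact subsets of $X$ with the Vietoris topology (generated by the subbase of sets $\{K:K\cap U\neq\emptyset\}$ and $\{K:K\subset U\}$, $U\subset X$ open). An attractor of $\mathcal F$ is a set $A\in\mathcal K(X)$ with $\mathcal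 F(A)=A$ such that for every $K\in\mathcal K(X)$ the sequence $(\mathcal F^n(K))_{n\ge1}$ converges to $A$ in $\mathcal K(X)$. $\mathcal F$ is compact-dominating if each compact $C\subset X$ is contained in a compact $K\subset X$ with $\mathcal F(K)\subset K$. $\mathcal F$ is topologically contracting if it is compact-dominating and for every non-empty compact $K\subset X$ with $\mathcal F(K)\subset K$ and every sequence $(f_n)_{n\in\omega}\in\mathcal F^\omega$ the intersection $\bigcap_{n\in\omega}f_0\circ\dots\circ f_n(K)$ is a singleton. For families of sets, $\mathcal U\prec\mathcal V$ means that each $U\in\mathcal U$ is contained in some $V\in\mathcal V$. $\mathcal F$ is compactly contracting if $\mathcal F(C)\subset C$ for some non-empty compact $C\subset X$ and for every compact $K\subset X$ and every open cover $\mathcal U$ of $X$ there is $n\in\omega$ with $\{f(K):f\in\mathcal F^{\ge n}\}\prec\mathcal U$. $\mathcal F$ is locally contracting if $\mathcal F(C)\subset C$ for some non-empty compact $C\subset X$ and for every compact $K\subset X$ and every open cover $\mathcal U$ of $X$ there are a neighborhood $O_K$ of $K$ in $X$ and $n\in\omega$ with $\{f(O_K):f\in\mathcal F^{\ge n}\}\prec\mathcal U$. $\mathcal F$ is Edelstein contracting with respect to $\mathcal D$ if for every $d\in\mathcal D$, $f\in\mathcal F$ and points $x,y\in X$ there is a constant $\lambda<1$ such that $d(f(x),f(y))\le\lambda\cdot d(x,y)$. *)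

(* Defs.v *)
From HB Require Import structures.
From mathcomp Require Import all_boot all_order all_algebra.
From mathcomp Require Import all_classical all_reals all_analysis.

Set Implicit Arguments.
Unset Strict Implicit.
Unset Printing Implicit Defensive.

Import Order.TTheory GRing.Theory Num.Theory.
Local Open Scope classical_set_scope.
Local Open Scope ring_scope.

Section Multimetric.
Variables (R : realType).

Record is_pseudometric (X : Type) (d : X -> X -> R) : Prop := IsPseudometric {
  pm_ge0 : forall x y, 0 <= d x y ;
  pm_refl : forall x, d x x = 0 ;
  pm_sym : forall x y, d x y = d y x ;
  pm_triangle : forall x y z, d x z <= d x y + d y z }.

Record is_multimetric (X : Type) (D : set (X -> X -> R)) : Prop :=
  IsMultimetric {
    mm_pseudometric : forall d, D d -> is_pseudometric d ;
    mm_separated : forall x y, x <> y -> exists2 d, D d & 0 < d x y }.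

Definition multimetric_open (X : Type) (D : set (X -> X -> R)) (U : set X) :=
  forall x, U x -> exists (e : R) (E : set (X -> X -> R)),
    [/\ 0 < e, finite_set E, E `<=` D &
        \bigcap_(d in E) [set y | d x y < e] `<=` U].

(* The canonical topology, i.e. the smallest one making all [d] in [D] continuous,
   through the explicit description of its open sets. *)
Definition has_canonical_topology (X : topologicalType)
    (D : set (X -> X -> R)) :=
  forall U : set X, open U <-> multimetric_open D U.

End Multimetric.

Record function_system (X : topologicalType) := FunctionSystem {
  fs_maps :> set (X -> X) ;
  fs_finite : finite_set fs_maps ;
  fs_neq0 : fs_maps !=set0 ;
  fs_continuous : forall f, fs_maps f -> continuous f }.

Definition set_image (X : Type) (G : set (X -> X)) (A : set X) : set X :=
  \bigcup_(f in G) (f @` A).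

Fixpoint fs_pow (X : Type) (F : set (X -> X)) (n : nat) : set (X -> X) :=
  if n is m.+1 then [set f \o g | f in F & g in fs_pow F m] else [set id].

Definition fs_powge (X : Type) (F : set (X -> X)) (k : nat) : set (X -> X) :=
  \bigcup_(n in [set n | (k <= n)%N]) fs_pow F n.

Fixpoint comp_seq (X : Type) (f : nat -> X -> X) (n : nat) : X -> X :=
  if n is m.+1 then comp_seq f m \o f m.+1 else f 0%N.

Lemma fs_pow_finite (X : topologicalType) (F : function_system X) n :
  finite_set (fs_pow F n).
Proof.
elim: n => [|n IHn] /=; first exact: finite_set1.
by apply: finite_image2 => //; exact: fs_finite.
Qed.

Lemma fs_pow_neq0 (X : topologicalType) (F : function_system X) n :
  fs_pow F n !=set0.
Proof.
elim: n => [|n [g Fg]]; first by exists id.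
by have [f Ff] := fs_neq0 F; exists (f \o g); exists f => //; exists g.
Qed.

Lemma fs_pow_continuous (X : topologicalType) (F : function_system X) n f :
  fs_pow F n f -> continuous f.
Proof.
elim: n f => [f -> x|n IHn _ [f Ff [g Fg <-]] x]; first exact: cvg_id.
by apply: continuous_comp; [exact: IHn Fg x|exact: fs_continuous Ff _].
Qed.

Record hyperspace (X : topologicalType) := Hyperspace {
  hset :> set X ;
  hset_compact : compact hset ;
  hset_neq0 : hset !=set0 }.

HB.instance Definition _ (X : topologicalType) := gen_eqMixin (hyperspace X).
HB.instance Definition _ (X : topologicalType) :=
  gen_choiceMixin (hyperspace X).

Definition vietoris_subbase (X : topologicalType) : set (set (hyperspace X)) :=
  [set W | exists2 U : set X, open U &
     W = [set K : hyperspace X | (K `&` U) !=set0] \/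
     W = [set K : hyperspace X | K `<=` U]].

HB.instance Definition _ (X : topologicalType) :=
  isSubBaseTopological.Build (hyperspace X) (@vietoris_subbase X) id.

Lemma set_image_pow_compact (X : topologicalType) (F : function_system X) n
  (K : hyperspace X) : compact (set_image (fs_pow F n) K).
Proof.
rewrite /set_image -bigsetU_fset_set; last exact: fs_pow_finite.
rewrite big_seq; apply: bigsetU_compact => f.
rewrite in_fset_set; last exact: fs_pow_finite.
rewrite inE => Ff; apply: continuous_compact; last exact: hset_compact.
by apply: continuous_subspaceT; exact: fs_pow_continuous Ff.
Qed.

Lemma set_image_pow_neq0 (X : topologicalType) (F : function_system X) n
  (K : hyperspace X) : set_image (fs_pow F n) K !=set0.
Proof.
have [f Ff] := fs_pow_neq0 F n; have [x Kx] := hset_neq0 K.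
by exists (f x); exists f => //; exists x.
Qed.

Definition hyper_pow (X : topologicalType) (F : function_system X) (n : nat)
    (K : hyperspace X) : hyperspace X :=
  Hyperspace (@set_image_pow_compact X F n K) (@set_image_pow_neq0 X F n K).

Section Contracting.
Variables (X : topologicalType) (F : function_system X).

Definition is_attractor (A : hyperspace X) :=
  set_image F A = A /\
  forall K : hyperspace X, (fun n => hyper_pow F n.+1 K) @ \oo --> A.

Definition has_attractor := exists A : hyperspace X, is_attractor A.

Definition compact_dominating :=
  forall C : set X, compact C ->
    exists K : set X, [/\ compact K, C `<=` K & set_image F K `<=` K].

Definition topologically_contracting :=
  compact_dominating /\
  forall K : set X, compact K -> K !=set0 -> set_image F K `<=` K ->
    forall f : nat -> X -> X, (forall n, fs_maps F (f n)) ->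
      exists x, \bigcap_n (comp_seq f n @` K) = [set x].

Definition open_cover (U : set (set X)) :=
  (forall V, U V -> open V) /\ \bigcup_(V in U) V = [set: X].

Definition refines (U V : set (set X)) :=
  forall A, U A -> exists2 B, V B & A `<=` B.

Definition has_invariant_compact :=
  exists C : set X, [/\ compact C, C !=set0 & set_image F C `<=` C].

Definition compactly_contracting :=
  has_invariant_compact /\
  forall (K : set X) (U : set (set X)), compact K -> open_cover U ->
    exists n : nat, refines [set f @` K | f in fs_powge F n] U.

Definition locally_contracting :=
  has_invariant_compact /\
  forall (K : set X) (U : set (set X)), compact K -> open_cover U ->
    exists (O : set X) (n : nat),
      set_nbhs K O /\ refines [set f @` O | f in fs_powge F n] U.

Definition Edelstein_contracting (R : realType) (D : set (X -> X -> R)) :=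
  forall d f x y, D d -> fs_maps F f ->
    exists2 l : R, l < 1 & d (f x) (f y) <= l * d x y.

End Contracting.

(* Main.v *)
Require Import Defs.
From mathcomp Require Import all_boot all_order all_algebra.
From mathcomp Require Import all_classical all_reals all_analysis.
From mathcomp Require Import lra.

Set Implicit Arguments.
Unset Strict Implicit.
Unset Printing Implicit Defensive.

Import Order.TTheory GRing.Theory Num.Theory.
Local Open Scope classical_set_scope.
Local Open Scope ring_scope.

(** Call a gauge a pseudometric that is continuous on [X], is not increased by
    the maps of [F] and is strictly decreased by them wherever it is positive.
    By the Edelstein condition every member of the multimetric is a gauge, and
    gauges are stable under finite maxima and positive multiples. So the
    finitely many pseudometrics and the radius in a basic neighborhood can be
    merged into one gauge and the radius 1: the unit balls of gauges form a base
    of neighborhoods ([multimetric_gauged]), and every open cover of a compact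
    set has a gauge as its Lebesgue number ([lebesgue_gauge]).

    The conditions are linked through the property that long compositions make
    the diameter of each compact set less than 1 for each gauge
    ([shrinks_compacts]).

    A compact set [K] with [F(K)] inside [K] always shrinks
    ([invariant_compact_shrinks]): by compactness the strict decrease of a gauge
    [p] on the pairs of [K] with [p x y >= 1] is bounded below by some [h > 0],
    so [p] loses at least [h] at each step until it falls below 1. Therefore a
    compact-dominating system shrinks all compact sets, and it is topologically
    contracting since two points in one nested intersection of images of [K]
    are at distance less than 1 for every gauge.

    Compact contraction gives shrinking by using covers by small balls.
    Conversely, when an invariant compact set [C] exists, shrinking [K] together
    with [C] places each late image of [K] near a point of [C], hence inside a
    member of the given cover by the Lebesgue property on [C]; as the maps do not
    increase gauges, this persists for a small neighborhood of [K], which is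
    local contraction. The attractor is the intersection of the sets [F^n(C)]:
    the points of [F^n(K)] follow those of [F^n(C)].

    Finally, if [F] has an attractor [A], then [A] together with all the sets
    [F^n(C)] is a compact invariant set containing the compact set [C], as these
    sets converge to [A]. *)

(** * Compactness *)

(** A property of sets that is hereditary, finitely additive and locally true
    holds for a compact set: otherwise the sets [S] for which it holds on
    [K `\` S] form a proper filter without a cluster point in [K]. *)
Lemma compact_induction (T : topologicalType) (K : set T) (P : set T -> Prop) :
    compact K -> P set0 -> (forall A B, A `<=` B -> P B -> P A) ->
    (forall A B, P A -> P B -> P (A `|` B)) ->
    (forall x, K x -> exists2 V, nbhs x V & P V) ->
  P K.
Proof.
move=> cK P0 Psub PU Ploc; apply: contrapT => nPK.
pose G : set_system T := [set S | P (K `\` S)].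
have GF : ProperFilter G.
  apply: Build_ProperFilter_ex => [S GS|].
    apply: contrapT => S0; apply: nPK; apply: Psub GS => x Kx; split => //.
    by move=> Sx; apply: S0; exists x.
  split=> [|A B GA GB|A B AB GA]; rewrite /G /=.
  - by apply: Psub P0 => x [_]; apply.
  - apply: Psub (PU _ _ GA GB) => x [Kx nAB].
    have [Ax|nAx] := pselect (A x); last by left.
    by right; split => // Bx; apply: nAB.
  - by apply: Psub GA => x [Kx nB]; split => // /AB.
have [|x [Kx clx]] := cK G GF; first by apply: Psub P0 => x [].
have [V Vx PV] := Ploc x Kx.
have GV : G (~` V).
  by apply: Psub PV => y [_ nnV]; apply: contrapT.
by have [y []] := clx _ _ GV Vx.
Qed.

(** Each point of [C 0] has a neighborhood that either lies in [W] or misses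
    some [C N]; finitely many of them suffice. *)
Lemma decreasing_compact_sub (T : topologicalType) (C : nat -> set T)
    (W : set T) :
    compact (C 0%N) -> (forall n, closed (C n)) ->
    (forall n m, (n <= m)%N -> C m `<=` C n) ->
    (forall x, (\bigcap_n C n) x -> nbhs x W) ->
  exists N, C N `<=` W.
Proof.
move=> cC0 clC Cdec CW.
suff [N CN] : exists N, C 0%N `&` C N `<=` W.
  by exists N => x Cx; apply: CN; split => //; exact: Cdec Cx.
apply: (compact_induction (P := fun S => exists N, S `&` C N `<=` W) cC0).
- by exists 0%N => x [].
- by move=> A B AB [N BN]; exists N => x [/AB Bx CNx]; apply: BN.
- move=> A B [N AN] [M BM]; exists (maxn N M) => x [[Ax|Bx] Cx].
  + by apply: AN; split => //; apply: Cdec Cx; exact: leq_maxl.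
  + by apply: BM; split => //; apply: Cdec Cx; exact: leq_maxr.
- move=> x _; have [Cx|/existsNP[N /not_implyP[_ nCx]]] :=
    pselect (forall n, setT n -> C n x).
    by exists W; [exact: CW|exists 0%N => y []].
  exists (~` C N); last by exists N => y [].
  by apply: open_nbhs_nbhs; split => //; exact: closed_openC.
Qed.

Lemma decreasing_compact_neq0 (T : topologicalType) (C : nat -> set T) :
    compact (C 0%N) -> (forall n, closed (C n)) ->
    (forall n m, (n <= m)%N -> C m `<=` C n) -> (forall n, C n !=set0) ->
  \bigcap_n C n !=set0.
Proof.
move=> cC0 clC Cdec C0; apply: contrapT => I0.
have [N CN0] : exists N, C N `<=` set0.
  apply: decreasing_compact_sub => // x Ix.
  by case: I0; exists x.
by have [x /CN0] := C0 N.
Qed.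

(** A set that consists of a compact limit and the compact sets converging to it
    is compact: a filter with no cluster point in [A] contains the complement of
    a neighborhood of [A], hence lives on finitely many of the [B n]. *)
Lemma compact_setU_bigcup (T : topologicalType) (A : set T) (B : nat -> set T) :
    compact A -> (forall n, compact (B n)) ->
    (forall U, open U -> A `<=` U ->
      exists N, forall n, (N <= n)%N -> B n `<=` U) ->
  compact (A `|` \bigcup_n B n).
Proof.
move=> cA cB BU G GF GK; apply: contrapT => ncl.
have [V [oV AV [W GW VW]]] : exists V, [/\ open V, A `<=` V &
    exists2 W, G W & V `&` W `<=` set0].
  apply: (compact_induction (P := fun S => exists V, [/\ open V, S `<=` V &
    exists2 W, G W & V `&` W `<=` set0]) cA).
  - exists set0; split => //; first exact: open0.
    by exists setT; [exact: filterT|move=> x []].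
  - by move=> S1 S2 S12 [V [oV SV GV]]; exists V; split => // x /S12 /SV.
  - move=> S1 S2 [V1 [oV1 SV1 [W1 GW1 VW1]]] [V2 [oV2 SV2 [W2 GW2 VW2]]].
    exists (V1 `|` V2); split; first exact: openU.
      by move=> x [/SV1|/SV2]; [left|right].
    exists (W1 `&` W2); first exact: filterI.
    by move=> x [[Vx|Vx] [W1x W2x]]; [apply: (VW1 x)|apply: (VW2 x)].
  - move=> x Ax.
    have /existsNP[W /existsNP[V /not_implyP[GW /not_implyP[nV WV0]]]] :
        ~ cluster G x.
      by move=> clx; apply: ncl; exists x; split => //; left.
    have [V' [oV' V'x] V'V] : exists2 V', open_nbhs x V' & V' `<=` V.
      by have := nV; rewrite nbhsE.
    exists V'; first exact: (open_nbhs_nbhs (conj oV' V'x)).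
    exists V'; split => //; exists W => // y [/V'V Vy Wy].
    by apply: WV0; exists y.
have [N BN] := BU V oV AV.
have cBN : compact (\big[setU/set0]_(i < N) B i).
  by apply: bigsetU_compact.
have [|x [Bx clx]] := cBN G GF.
  apply: filterS (filterI GK GW) => x [[Ax|[n _ Bx]] Wx].
    by have := VW x (conj (AV _ Ax) Wx).
  have [nN|Nn] := ltnP n N; last by have := VW x (conj (BN n Nn _ Bx) Wx).
  by rewrite -bigcup_mkord; exists n.
apply: ncl; exists x; split => //; right.
by move: Bx; rewrite -bigcup_mkord => -[n _ Bx]; exists n.
Qed.

(** * The Vietoris topology *)

Lemma vietoris_open_sub (X : topologicalType) (U : set X) :
  open U -> open [set K : hyperspace X | K `<=` U].
Proof.
move=> oU; exists [set [set K : hyperspace X | K `<=` U]].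
  by move=> _ ->; apply: finI_from1; exists U => //; right.
by rewrite bigcup_set1.
Qed.

Lemma vietoris_cvg (X : topologicalType) (u : nat -> hyperspace X)
    (A : hyperspace X) :
    (forall U, open U -> A `&` U !=set0 ->
      \forall n \near \oo, u n `&` U !=set0) ->
    (forall U, open U -> A `<=` U -> \forall n \near \oo, u n `<=` U) ->
  u @ \oo --> A.
Proof.
move=> meetU subU W; rewrite nbhsE => -[B [[S SD <-] [V SV VA]] BW].
have [s ssub sV] : finI_from (@vietoris_subbase X) id V := SD _ SV.
suff uV : \forall n \near \oo, (V : set (hyperspace X)) (u n).
  by apply: filterS uV => n Vn; apply: BW; exists V.
rewrite -sV; apply: (@filter_bigI _ _ s (fun Q => [set n | Q (u n)])).
move=> Q /[dup] sQ /ssub /set_mem /= [U oU defQ].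
have QA : Q A by move: VA; rewrite -sV; apply.
by case: defQ QA => -> QA; [exact: meetU|exact: subU].
Qed.

(** * Iterates of a function system *)

Section Iterates.
Context (X : topologicalType) (F : function_system X).

Lemma fs_pow_comp n m g h :
  fs_pow F n g -> fs_pow F m h -> fs_pow F (n + m) (g \o h).
Proof.
elim: n g => [g -> //|n IHn _ [f Ff [g Fg <-]] Fh].
by exists f => //; exists (g \o h) => //; exact: IHn.
Qed.

Lemma fs_pow1 f : fs_maps F f -> fs_pow F 1 f.
Proof. by move=> Ff; exists f => //; exists id. Qed.

(** The powers of [F] are defined by adding a map on the left; splitting one off
    on the right makes the sets [F^n(C)] decrease when [F(C)] lies in [C]. *)
Lemma fs_pow_succr n g : fs_pow F n.+1 g ->
  exists h f, [/\ fs_pow F n h, fs_maps F f & g = h \o f].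
Proof.
elim: n g => [_ [f Ff [_ -> <-]]|n IHn _ [f Ff [g /IHn[h [k [Fh Fk ->]]] <-]]].
  by exists id, f.
by exists (f \o h), k; split => //; exists f => //; exists h.
Qed.

Lemma comp_seq_pow (f : nat -> X -> X) n :
  (forall n, fs_maps F (f n)) -> fs_pow F n.+1 (comp_seq f n).
Proof.
move=> Ff; elim: n => [|n IHn]; first exact: (fs_pow1 (Ff 0%N)).
by rewrite -[n.+2]addn1; exact: (fs_pow_comp IHn (fs_pow1 (Ff n.+1))).
Qed.

Lemma fs_pow_invariant {C : set X} {n g x} :
  set_image F C `<=` C -> fs_pow F n g -> C x -> C (g x).
Proof.
move=> FC; elim: n g => [g -> //|n IHn _ [f Ff [g Fg <-]] Cx].
by apply: FC; exists f => //; exists (g x) => //; exact: IHn.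
Qed.

Lemma set_image_pow_succ (C : set X) n :
  set_image (fs_pow F n.+1) C = set_image F (set_image (fs_pow F n) C).
Proof.
apply/seteqP; split=> [_ [_ [f Ff [g Fg <-]] [x Cx <-]]|].
  by exists f => //; exists (g x) => //; exists g => //; exists x.
move=> _ [f Ff [_ [g Fg [x Cx <-]] <-]].
by exists (f \o g); [exists f => //; exists g|exists x].
Qed.

Lemma set_image_pow_decreasing (C : set X) n m : set_image F C `<=` C ->
  (n <= m)%N -> set_image (fs_pow F m) C `<=` set_image (fs_pow F n) C.
Proof.
move=> FC /subnK <-; elim: (m - n)%N => // k IHk; apply: subset_trans IHk.
move=> _ [g /fs_pow_succr[h [f [Fh Ff ->]]] [x Cx <-]].
by exists h => //; exists (f x) => //; apply: FC; exists f => //; exists x.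
Qed.

End Iterates.

(** * Gauges *)

(** This turns one witness for each element of a finite set into a common one. It
    serves to merge finitely many pseudometrics into a gauge, and the gaps of
    finitely many maps into a single positive number. *)
Lemma finite_directed (T : choiceType) (I : Type) (E : set T) (G : set I)
    (Q : T -> I -> Prop) :
    finite_set E -> G !=set0 ->
    (forall i j, G i -> G j ->
      exists2 k, G k & forall t, Q t i \/ Q t j -> Q t k) ->
    (forall t, E t -> exists2 i, G i & Q t i) ->
  exists2 i, G i & forall t, E t -> Q t i.
Proof.
move=> /finite_seqP[s ->] G0 Gdir; elim: s => [_|t s IHs EQ].
  by have [i Gi] := G0; exists i.
have [|i Gi Qi] := IHs.
  by move=> u su; apply: EQ; rewrite /= inE su orbT.
have [|j Gj Qj] := EQ t; first by rewrite /= inE eqxx.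
have [k Gk Qk] := Gdir i j Gi Gj.
exists k => // u; rewrite /= inE => /predU1P[->|/Qi Qui]; apply: Qk.
  by right.
by left.
Qed.

Section Gauges.
Context (R : realType) (X : topologicalType) (F : function_system X).

(** The last two fields together are the Edelstein condition freed of its factor:
    the factor can be taken to be [p (f x) (f y) / p x y] if [p x y > 0]. *)
Record gauge (p : X -> X -> R) : Prop := Gauge {
  gauge_pseudometric : is_pseudometric p;
  gauge_nbhs : forall x e, 0 < e -> nbhs x [set y | p x y < e];
  gauge_nonexpansive : forall f x y, fs_maps F f -> p (f x) (f y) <= p x y;
  gauge_contracts : forall f x y, fs_maps F f -> 0 < p x y ->
    p (f x) (f y) < p x y }.

Lemma gauge_pow p n g x y :
  gauge p -> fs_pow F n g -> p (g x) (g y) <= p x y.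
Proof.
move=> Gp; elim: n g => [g -> //|n IHn _ [f Ff [g Fg <-]]].
exact: le_trans (gauge_nonexpansive Gp _ _ Ff) (IHn g Fg).
Qed.

Lemma gauge_scale c p : 0 < c -> gauge p -> gauge (fun x y => c * p x y).
Proof.
move=> c0 Gp; have [p0 pr ps pt] := gauge_pseudometric Gp; split.
- split=> [x y|x|x y|x y z].
  + by rewrite mulr_ge0// ltW.
  + by rewrite pr mulr0.
  + by rewrite ps.
  + by rewrite -mulrDr ler_pM2l.
- move=> x e e0; have := gauge_nbhs Gp x (divr_gt0 e0 c0).
  by apply: filterS => y /=; rewrite ltr_pdivlMr// mulrC.
- by move=> f x y Ff; rewrite ler_pM2l//; exact: (gauge_nonexpansive Gp).
- move=> f x y Ff; rewrite pmulr_rgt0// ltr_pM2l//.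
  exact: (gauge_contracts Gp).
Qed.

(** Strictness survives since [r (f x) (f y)] is below the maximum for each of
    the two gauges [r]: either [r x y > 0] and [r] decreases, or
    [r (f x) (f y) <= 0]. *)
Lemma gauge_max p q :
  gauge p -> gauge q -> gauge (fun x y => Num.max (p x y) (q x y)).
Proof.
move=> Gp Gq; have [p0 pr ps pt] := gauge_pseudometric Gp.
have [q0 qr qs qt] := gauge_pseudometric Gq; split.
- split=> [x y|x|x y|x y z].
  + by rewrite le_max p0.
  + by rewrite pr qr maxxx.
  + by rewrite ps qs.
  + rewrite ge_max; apply/andP; split.
      by apply: le_trans (pt x y z) _; apply: lerD; rewrite le_max lexx.
    by apply: le_trans (qt x y z) _; apply: lerD; rewrite le_max lexx orbT.
- move=> x e e0.
  apply: filterS (filterI (gauge_nbhs Gp x e0) (gauge_nbhs Gq x e0)).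
  by move=> y /= [pe qe]; rewrite gt_max pe qe.
- move=> f x y Ff; rewrite ge_max !le_max.
  by rewrite (gauge_nonexpansive Gp)// (gauge_nonexpansive Gq)// orbT.
- move=> f x y Ff m0.
  have contr r : gauge r -> r x y <= Num.max (p x y) (q x y) ->
      r (f x) (f y) < Num.max (p x y) (q x y).
    move=> Gr rm; have [r0|r0] := ltP 0 (r x y).
      exact: lt_le_trans (gauge_contracts Gr Ff r0) rm.
    by rewrite (le_lt_trans _ m0)// (le_trans (gauge_nonexpansive Gr _ _ Ff)).
  by rewrite gt_max !contr// le_max lexx ?orbT.
Qed.

Lemma gauge0 : gauge (fun _ _ => 0).
Proof.
split=> [|x e e0|//|f x y _]; last by rewrite ltxx.
  by split=> // *; rewrite addr0.
by apply: filterS filterT => y _.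
Qed.

(** The radius can be fixed to 1 because gauges can be rescaled. *)
Definition gauged := forall (x : X) U, nbhs x U ->
  exists2 p, gauge p & [set y | p x y < 1] `<=` U.

Section Canonical.
Variables (D : set (X -> X -> R)).
Hypotheses (D_multimetric : is_multimetric D).
Hypotheses (X_canonical : has_canonical_topology D).
Hypotheses (F_Edelstein : Edelstein_contracting F D).

Lemma multimetric_gauge d : D d -> gauge d.
Proof.
move=> Dd; have dpm := mm_pseudometric D_multimetric Dd.
have [d0 dr ds dt] := dpm.
have contr f x y : fs_maps F f -> d (f x) (f y) <= d x y /\
    (0 < d x y -> d (f x) (f y) < d x y).
  move=> Ff; have [l l1 dl] := F_Edelstein x y Dd Ff; split.
    by apply: le_trans dl _; rewrite ler_piMl// ltW.
  by move=> dxy; apply: le_lt_trans dl _; rewrite gtr_pMl.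
split=> [//|x e e0|f x y Ff|f x y Ff]; last 2 first.
- by have [] := contr f x y Ff.
- by have [] := contr f x y Ff.
apply: open_nbhs_nbhs; split; last by rewrite /= dr.
apply/X_canonical => y /= xy; exists (e - d x y), [set d]; split.
- by rewrite subr_gt0.
- exact: finite_set1.
- by move=> _ ->.
- move=> z /(_ d erefl) /= yz; have := dt x y z; lra.
Qed.

(** The maximum of the pseudometrics [d / e], for [d] in the finite family [E]
    and [e] the radius, has its unit ball inside each [d]-ball of radius [e]. *)
Lemma multimetric_gauged : gauged.
Proof.
move=> x U; rewrite nbhsE => -[V [/X_canonical oV Vx] VU].
have [e [E [e0 finE ED EV]]] := oV x Vx.
have [|||p Gp pE] := @finite_directed _ _ E gauge
    (fun d p => forall y z, d y z / e <= p y z) finE.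
- by exists (fun _ _ => 0); exact: gauge0.
- move=> p q Gp Gq; exists (fun x y => Num.max (p x y) (q x y)).
    exact: gauge_max.
  by move=> d [dp|dq] y z; rewrite le_max ?dp ?dq ?orbT.
- move=> d /ED /multimetric_gauge Gd; exists (fun x y => e^-1 * d x y).
    by apply: gauge_scale => //; rewrite invr_gt0.
  by move=> y z; rewrite mulrC.
- exists p => // y /= pxy; apply/VU/EV => d Ed /=.
  by rewrite -[e]mul1r -ltr_pdivrMr//; exact: le_lt_trans (pE d Ed x y) pxy.
Qed.

Lemma multimetric_gauge_separated x y :
  x <> y -> exists2 p, gauge p & 1 <= p x y.
Proof.
move=> /(mm_separated D_multimetric)[d Dd dxy].
exists (fun a b => (d x y)^-1 * d a b); last by rewrite mulVf// gt_eqF.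
by apply: gauge_scale; [rewrite invr_gt0|exact: multimetric_gauge].
Qed.

Lemma multimetric_hausdorff : hausdorff_space X.
Proof.
move=> x y clxy; apply: contrapT => /multimetric_gauge_separated[p Gp pxy].
have [p0 pr ps pt] := gauge_pseudometric Gp.
have [//|//|z [/= xz yz]] := clxy _ _ (gauge_nbhs Gp x (e := 1 / 2) _)
  (gauge_nbhs Gp y (e := 1 / 2) _); try lra.
by have := pt x z y; rewrite (ps z y); lra.
Qed.

End Canonical.

(** A gauge plays the part of a Lebesgue number. Locally it is twice a gauge whose
    unit ball at [x] lies in a member of the cover, and finitely many local
    gauges are merged by their maximum. *)
Lemma lebesgue_gauge (K : set X) (U : set (set X)) :
    gauged -> compact K -> (forall x, K x -> exists2 V, U V & nbhs x V) ->
  exists2 p, gauge p &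
    forall x, K x -> exists2 V, U V & [set y | p x y < 1] `<=` V.
Proof.
move=> Xg cK KU.
apply: (compact_induction (P := fun S => exists2 p, gauge p &
  forall x, S x -> exists2 V, U V & [set y | p x y < 1] `<=` V) cK).
- by exists (fun _ _ => 0) => //; exact: gauge0.
- by move=> A B AB [p Gp pB]; exists p => // x /AB /pB.
- move=> A B [p Gp pA] [q Gq qB].
  exists (fun x y => Num.max (p x y) (q x y)); first exact: gauge_max.
  move=> x [/pA|/qB] [V UV sV]; exists V => // y /=.
    by rewrite gt_max => /andP[/sV].
  by rewrite gt_max => /andP[_ /sV].
- move=> x /KU[V UV /Xg[p Gp pV]].
  have [p0 pr ps pt] := gauge_pseudometric Gp.
  exists [set y | p x y < 1 / 2]; first by apply: gauge_nbhs => //; lra.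
  exists (fun x y => 2 * p x y); first by apply: gauge_scale.
  move=> y /= xy; exists V => // z /= yz; apply: pV => /=.
  by have := pt x y z; lra.
Qed.

(** The strict inequality [p (f x) (f y) < p x y] alone bounds the decrease from
    below near [(x, y)], because [p] and [p] after [f] vary by at most the
    distances that [x] and [y] are moved; compactness of [K `*` K] then
    makes the bound uniform. *)
Lemma uniform_decrease (K : set X) p : compact K -> gauge p ->
  exists2 h, 0 < h & forall f x y, fs_maps F f -> K x -> K y -> 1 <= p x y ->
    p (f x) (f y) <= p x y - h.
Proof.
move=> cK Gp; have [p0 pr ps pt] := gauge_pseudometric Gp.
have [| | |h h0 Qh] := @finite_directed _ R F [set h | 0 < h]
    (fun f h => forall x y, K x -> K y -> 1 <= p x y ->
      p (f x) (f y) <= p x y - h) (fs_finite F).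
- by exists 1 => /=.
- move=> h k /= h0 k0; exists (Num.min h k); first by rewrite /= lt_min h0.
  have mh : Num.min h k <= h by rewrite ge_min lexx.
  have mk : Num.min h k <= k by rewrite ge_min lexx orbT.
  by move=> f [] Q x y Kx Ky xy; have := Q x y Kx Ky xy; lra.
- move=> f Ff.
  suff [h h0 Kh] : exists2 h, 0 < h & forall z, (K `*` K) z -> 1 <= p z.1 z.2 ->
      p (f z.1) (f z.2) <= p z.1 z.2 - h.
    by exists h => // x y Kx Ky; exact: (Kh (x, y)).
  apply: (compact_induction (P := fun S => exists2 h, 0 < h &
    forall z, S z -> 1 <= p z.1 z.2 -> p (f z.1) (f z.2) <= p z.1 z.2 - h)
    (compact_setX cK cK)).
  + by exists 1.
  + by move=> A B AB [h h0 Bh]; exists h => // z /AB /Bh.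
  + move=> A B [h h0 Ah] [k k0 Bk]; exists (Num.min h k).
      by rewrite lt_min h0.
    have mh : Num.min h k <= h by rewrite ge_min lexx.
    have mk : Num.min h k <= k by rewrite ge_min lexx orbT.
    by move=> z [/Ah|/Bk] Q /Q; lra.
  + move=> [x y] _ /=; have [xy1|xy1] := ltP (p x y) 1.
      (* Near such a pair the premise 1 <= p u v fails. *)
      pose r := (1 - p x y) / 2.
      exists ([set u | p x u < r] `*` [set v | p y v < r]).
        exists ([set u | p x u < r], [set v | p y v < r]) => //=.
        by split; apply: gauge_nbhs => //; rewrite /r; lra.
      exists 1 => // -[u v] [/= xu yv] uv.
      have := pt u x v; have := pt x y v; rewrite (ps u x) /r in xu yv *; lra.
    have := gauge_contracts Gp Ff (lt_le_trans ltr01 xy1) => fxy.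
    (* Moving x and y by less than r lowers p x y by at most 2r and raises
       p (f x) (f y) by at most 2r; a fifth of the gap remains. *)
    pose r := (p x y - p (f x) (f y)) / 5.
    exists ([set u | p x u < r] `*` [set v | p y v < r]).
      exists ([set u | p x u < r], [set v | p y v < r]) => //=.
      by split; apply: gauge_nbhs => //; rewrite /r; lra.
    exists r => [|[u v] [/= xu yv] uv]; first by rewrite /r; lra.
    have := pt (f u) (f x) (f v); have := pt (f x) (f y) (f v).
    have := pt x u y; have := pt u v y.
    have := gauge_nonexpansive Gp x u Ff; have := gauge_nonexpansive Gp y v Ff.
    by rewrite (ps (f u) (f x)) (ps v y); rewrite /r in xu yv *; lra.
- by exists h => // f x y Ff; exact: Qh.
Qed.

Lemma gauge_bounded (K : set X) p : compact K -> gauge p ->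
  exists M, forall x y, K x -> K y -> p x y <= M.
Proof.
move=> cK Gp; have [p0 pr ps pt] := gauge_pseudometric Gp.
have [->|/set0P[a Ka]] := eqVneq K set0; first by exists 0 => x y [].
suff [M KM] : exists M, forall x, K x -> p a x <= M.
  exists (M + M) => x y Kx Ky; have := pt x a y.
  by have := KM x Kx; have := KM y Ky; rewrite (ps x a); lra.
apply: (compact_induction (P := fun S => exists M, forall x, S x -> p a x <= M)
  cK).
- by exists 0.
- by move=> A B AB [M BM]; exists M => x /AB /BM.
- move=> A B [M AM] [N BN]; exists (Num.max M N) => x.
  by move=> [/AM|/BN] xM; rewrite le_max xM ?orbT.
- move=> x _; exists [set y | p x y < 1]; first exact: gauge_nbhs.
  by exists (p a x + 1) => y /= xy; have := pt a x y; lra.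
Qed.

(** Asking for diameters below 1 is enough to have them below every positive
    number, since a gauge can be multiplied by a large constant. *)
Definition shrinks (K : set X) := forall p, gauge p ->
  exists N, forall n g x y, (N <= n)%N -> fs_pow F n g -> K x -> K y ->
    p (g x) (g y) < 1.

(** While a gauge is at least 1 on the images of two points, each further map
    subtracts [h]; the total is bounded on [K], so it falls below 1 after a
    number of steps that depends only on [K], and then stays there. *)
Lemma invariant_compact_shrinks (K : set X) :
  compact K -> set_image F K `<=` K -> shrinks K.
Proof.
move=> cK FK p Gp; have [h h0 Kh] := uniform_decrease cK Gp.
have [M KM] := gauge_bounded cK Gp.
have dec n g x y : fs_pow F n g -> K x -> K y ->
    p (g x) (g y) < 1 \/ p (g x) (g y) <= M - n%:R * h.
  move=> + Kx Ky; elim: n g => [_ ->|n IHn _ [f Ff [g Fg <-]] /=].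
    by right; rewrite mul0r subr0; exact: KM.
  have [lt1|ge1] := ltP (p (g x) (g y)) 1.
    by left; exact: le_lt_trans (gauge_nonexpansive Gp _ _ Ff) lt1.
  have Kg u : K u -> K (g u) by exact: (fs_pow_invariant FK Fg).
  have := Kh f _ _ Ff (Kg x Kx) (Kg y Ky) ge1.
  have [|gM] := IHn g Fg; first by rewrite ltNge ge1.
  by right; rewrite -natr1 mulrDl mul1r; lra.
pose N := Num.bound (`|M| / h).
have MN : M < N%:R * h.
  rewrite (le_lt_trans (ler_norm M))// -ltr_pdivrMr// archi_boundP//.
  by rewrite divr_ge0// ltW.
exists N => n g x y Nn Fg Kx Ky; have [//|gM] := dec n g x y Fg Kx Ky.
have : N%:R * h <= n%:R * h by rewrite ler_pM2r// ler_nat.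
by lra.
Qed.

(** * The contraction conditions *)

Definition shrinks_compacts := forall K : set X, compact K -> shrinks K.

Lemma compact_dominating_shrinks : compact_dominating F -> shrinks_compacts.
Proof.
move=> Fdom K cK p Gp; have [K' [cK' KK' FK']] := Fdom K cK.
have [N KN] := invariant_compact_shrinks cK' FK' Gp.
by exists N => n g x y Nn Fg /KK' Kx /KK' Ky; exact: KN Fg Kx Ky.
Qed.

(** Compact contraction is applied to the cover by the open sets of diameter
    below 1. *)
Lemma compactly_contracting_shrinks :
  compactly_contracting F -> shrinks_compacts.
Proof.
move=> [_ Fcc] K cK p Gp; have [p0 pr ps pt] := gauge_pseudometric Gp.
have [|N KN] := Fcc K [set V | open V /\
    forall x y, V x -> V y -> p x y < 1] cK.
  split=> [V []//|]; apply/seteqP; split=> // x _.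
  have h0 : 0 < 1 / 2 :> R by lra.
  have := gauge_nbhs Gp x h0; rewrite nbhsE => -[V [oV Vx] Vp].
  exists V => //; split=> // y z /Vp /= xy /Vp /= xz.
  by have := pt y x z; rewrite (ps y x); lra.
exists N => n g x y Nn Fg Kx Ky.
have [|V [_ Vp] gV] := KN (g @` K).
  by exists g => //; exists n.
by apply: Vp; apply: gV; [exists x|exists y].
Qed.

Lemma locally_contracting_compactly :
  locally_contracting F -> compactly_contracting F.
Proof.
move=> [Finv Flc]; split=> // K U cK oU.
have [N [n [/set_nbhsP[V [_ KV VO]] NU]]] := Flc K U cK oU.
exists n => _ [g [m nm Fg] <-].
have [|W UW gWO] := NU (g @` N).
  by exists g => //; exists m.
by exists W => // _ [x Kx <-]; apply: gWO; exists x => //; exact/VO/KV.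
Qed.

Section Gauged.
Hypotheses (X_gauged : gauged) (X_hausdorff : hausdorff_space X).

(** The invariant set [C] anchors the images: with [c] in [C], each late image of
    [K] stays close to the image of [c], which lies in [C], where the cover has a
    Lebesgue gauge. The images of the points at distance less than 1/2 from [K]
    are still at distance less than 1 from that of [c]. *)
Lemma shrinks_locally_contracting :
  has_invariant_compact F -> shrinks_compacts -> locally_contracting F.
Proof.
move=> Finv Fsh; split=> // K U cK [oU covU].
have [C [cC [c Cc] FC]] := Finv.
have [p Gp pC] : exists2 p, gauge p & forall x, C x ->
    exists2 V, U V & [set y | p x y < 1] `<=` V.
  apply: lebesgue_gauge => // x _; have [V UV Vx] : (\bigcup_(V in U) V) x.
    by rewrite covU.
  by exists V => //; apply: open_nbhs_nbhs; split => //; exact: oU.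
have [p0 pr ps pt] := gauge_pseudometric Gp.
have [N KN] := Fsh (K `|` C) (compactU cK cC) _ (gauge_scale (ltr0Sn R 1) Gp).
exists [set y | exists2 x, K x & p x y < 1 / 2], N; split.
  move=> x Kx; have h0 : 0 < 1 / 2 :> R by lra.
  by apply: filterS (gauge_nbhs Gp x h0) => y /= xy; exists x.
move=> _ [g [n Nn Fg] <-].
have [V UV pV] := pC (g c) (fs_pow_invariant FC Fg Cc).
exists V => // _ [y [x Kx xy] <-]; apply: pV => /=.
have := KN n g c x Nn Fg (or_intror Cc) (or_introl Kx) => /=.
by have := gauge_pow x y Gp Fg; have := pt (g c) (g x) (g y); lra.
Qed.

Section Attractor.
Variable C : hyperspace X.
Hypothesis FC : set_image F C `<=` C.

Let A_set := \bigcap_n (hyper_pow F n C : set X).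

Let closed_pow n : closed (hyper_pow F n C : set X).
Proof. by apply: compact_closed => //; exact: hset_compact. Qed.

Let pow0 : compact (hyper_pow F 0 C : set X).
Proof. exact: hset_compact. Qed.

Let A_compact : compact A_set.
Proof.
apply: subclosed_compact pow0 _; last by move=> x; apply.
by apply: closed_bigI => n _; exact: closed_pow.
Qed.

Let A_neq0 : A_set !=set0.
Proof.
apply: decreasing_compact_neq0 => //.
- by move=> n m; exact: set_image_pow_decreasing.
- by move=> n; exact: hset_neq0.
Qed.

Definition limit_set := Hyperspace A_compact A_neq0.

Let pow_near (W : set X) : (forall x, A_set x -> nbhs x W) ->
  exists N, forall n, (N <= n)%N -> (hyper_pow F n C : set X) `<=` W.
Proof.
move=> AW; have dec n m : (n <= m)%N ->
    (hyper_pow F m C : set X) `<=` (hyper_pow F n C : set X).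
  exact: set_image_pow_decreasing.
have [N CN] := decreasing_compact_sub pow0 closed_pow dec AW.
by exists N => n Nn; apply: subset_trans CN; exact: dec.
Qed.

(** If some [x] in the limit were not in the image of the limit, a gauge would
    keep it at distance at least 1 from that compact image. But [x] is the image
    under some [f] of a point that is closer than 1 to the limit, and [f] does not
    increase gauges. *)
Lemma limit_set_invariant : set_image F limit_set = limit_set.
Proof.
apply/seteqP; split=> [_ [f Ff [a Aa <-]] n _|].
  apply: (set_image_pow_decreasing FC (leqnSn n)).
  by rewrite set_image_pow_succ; exists f => //; exists a => //; exact: Aa.
move=> x Ax; apply: contrapT => nFAx.
have cFA : closed (set_image F limit_set).
  have -> : set_image F limit_set = (hyper_pow F 1 limit_set : set X).
    rewrite -[RHS]/(set_image (fs_pow F 1) limit_set) set_image_pow_succ.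
    by rewrite [in RHS]/set_image /= bigcup_set1 image_id.
  by apply: compact_closed => //; exact: hset_compact.
have [p Gp px] := X_gauged (open_nbhs_nbhs (conj (closed_openC cFA) nFAx)).
have [p0 pr ps pt] := gauge_pseudometric Gp.
have [|N CN] := @pow_near [set y | exists2 a, A_set a & p a y < 1].
  by move=> a Aa; apply: filterS (gauge_nbhs Gp a ltr01) => y; exists a.
have : set_image (fs_pow F N.+1) C x by exact: Ax.
rewrite set_image_pow_succ => -[f Ff [y /(CN N (leqnn N))[a Aa ay] fyx]].
case: (px (f a)); last by exists f => //; exists a.
rewrite /= -fyx ps; exact: le_lt_trans (gauge_nonexpansive Gp a y Ff) ay.
Qed.

(** For a point [c] of [C] and a point [k] of [K], the images [g c] and [g k] under
    long compositions are close. So [F^n(K)] meets every open set that meets the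
    limit, whose points have the form [g c], and stays in every neighborhood of the
    limit, as [F^n(C)] does. *)
Lemma limit_set_attractor : shrinks_compacts -> is_attractor F limit_set.
Proof.
move=> Fsh; split=> [|K]; first exact: limit_set_invariant.
have cKC : compact (K `|` C) by apply: compactU; exact: hset_compact.
apply: vietoris_cvg => U oU.
- move=> [a [Aa Ua]].
  have [p Gp pU] := X_gauged (open_nbhs_nbhs (conj oU Ua)).
  have [N KN] := Fsh _ cKC p Gp.
  exists N => // n /= Nn; have [k Kk] := hset_neq0 K.
  have [g Fg [c Cc gca]] := Aa n.+1 I.
  exists (g k); split; first by exists g => //; exists k.
  apply: pU; rewrite /= -gca.
  exact: (KN n.+1 g c k (leqW Nn) Fg (or_intror Cc) (or_introl Kk)).
- move=> AU.
  have [p Gp pU] : exists2 p, gauge p & forall x, A_set x ->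
      exists2 V, [set U] V & [set y | p x y < 1] `<=` V.
    apply: lebesgue_gauge => // x Ax; exists U => //.
    by apply: open_nbhs_nbhs; split => //; exact: AU.
  have [p0 pr ps pt] := gauge_pseudometric Gp.
  have [N KN] := Fsh _ cKC _ (gauge_scale (ltr0Sn R 1) Gp).
  have [|M CM] := @pow_near [set y | exists2 a, A_set a & p a y < 1 / 2].
    move=> a Aa; have h0 : 0 < 1 / 2 :> R by lra.
    by apply: filterS (gauge_nbhs Gp a h0) => y; exists a.
  exists (maxn N M) => // n /=; rewrite geq_max => /andP[Nn Mn].
  move=> _ [g Fg [k Kk <-]]; have [c Cc] := hset_neq0 C.
  have [|a Aa ay] := CM n.+1 (leqW Mn) (g c).
    by exists g => //; exists c.
  have [_ -> pa] := pU a Aa; apply: pa => /=.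
  have := KN n.+1 g c k (leqW Nn) Fg (or_intror Cc) (or_introl Kk) => /=.
  by have := pt a (g c) (g k); lra.
Qed.

End Attractor.

Lemma shrinks_has_attractor :
  has_invariant_compact F -> shrinks_compacts -> has_attractor F.
Proof.
move=> [C [cC C0 FC]] Fsh; exists (@limit_set (Hyperspace cC C0) FC).
exact: limit_set_attractor.
Qed.

(** The sets [f_0 o ... o f_n (K)] decrease, so their intersection is nonempty; a
    gauge that is at least 1 at two of its points would contradict the shrinking
    of [K]. *)
Lemma compact_dominating_topologically :
    (forall x y : X, x <> y -> exists2 p, gauge p & 1 <= p x y) ->
  compact_dominating F -> topologically_contracting F.
Proof.
move=> Xsep Fdom; split=> // K cK K0 FK f Ff.
have Ffn n : fs_pow F n.+1 (comp_seq f n) by exact: comp_seq_pow.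
have cfK n : compact (comp_seq f n @` K).
  apply: continuous_compact => //; apply: continuous_subspaceT.
  exact: fs_pow_continuous (Ffn n).
have [x Ix] : \bigcap_n (comp_seq f n @` K) !=set0.
  apply: decreasing_compact_neq0 => //.
  - by move=> n; exact: compact_closed.
  - move=> n m /subnK <-; elim: (m - n)%N => // k IHk.
    apply: subset_trans IHk => _ [x Kx <-].
    exists (f (k + n).+1 x) => //; apply: FK.
    by exists (f (k + n).+1) => //; exists x.
  - by move=> n; have [a Ka] := K0; exists (comp_seq f n a); exists a.
exists x; apply/seteqP; split=> [y Iy|_ -> //].
apply: contrapT => /Xsep[p Gp pyx].
have [N KN] := invariant_compact_shrinks cK FK Gp.
have [[a Ka ax] [b Kb by_]] := (Ix N I, Iy N I).
have := KN N.+1 _ b a (leqnSn N) (Ffn N) Kb Ka.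
by rewrite ax by_ ltNge pyx.
Qed.

End Gauged.

(** The dominating set is the attractor together with the whole orbit of [C],
    which starts with [F^0(C) = C]. *)
Lemma attractor_compact_dominating :
  has_attractor F -> compact_dominating F.
Proof.
move=> [A [FA AK]] C cC.
have [->|/set0P C0] := eqVneq C set0.
  by exists set0; split => //; [exact: compact0|move=> _ [f _ [x []]]].
pose K := Hyperspace cC C0.
exists (A `|` \bigcup_n (hyper_pow F n K : set X)); split.
- apply: (@compact_setU_bigcup _ A (fun n => hyper_pow F n K))
    => [|n|U oU AU]; try exact: hset_compact.
  have /(AK K)[N _ NU] : nbhs A [set L : hyperspace X | L `<=` U].
    by apply: open_nbhs_nbhs; split => //; exact: vietoris_open_sub.
  by exists N.+1 => -[//|n] Nn; exact: (NU n).
- by move=> x Cx; right; exists 0%N => //; exists id => //; exists x.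
- move=> _ [f Ff [x [Ax|[n _ nx]] <-]].
    by left; rewrite -FA; exists f => //; exists x.
  right; exists n.+1 => //=; rewrite set_image_pow_succ.
  by exists f => //; exists x.
Qed.

Lemma compact_dominating_invariant : [set: X] !=set0 ->
  compact_dominating F -> has_invariant_compact F.
Proof.
move=> [x _] /(_ _ (@compact_set1 _ x))[K [cK xK FK]].
by exists K; split => //; exists x; exact: xK.
Qed.

End Gauges.

Theorem theorem5p8 (R : realType) (X : topologicalType)
    (D : set (X -> X -> R)) (F : function_system X)
    (X_neq0 : [set: X] !=set0)
    (D_multimetric : is_multimetric D)
    (X_canonical : has_canonical_topology D)
    (F_Edelstein : Edelstein_contracting F D) :
  [<-> topologically_contracting F;
       compactly_contracting F;
       locally_contracting F;
       has_attractor F;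
       compact_dominating F].
Proof.
have Xg := multimetric_gauged D_multimetric X_canonical F_Edelstein.
have Xh := multimetric_hausdorff D_multimetric X_canonical F_Edelstein.
tfae.
- move=> [Fdom _]; apply: locally_contracting_compactly.
  apply: (shrinks_locally_contracting Xg).
    exact: compact_dominating_invariant.
  exact: compact_dominating_shrinks.
- move=> Fcc; apply: (shrinks_locally_contracting Xg); first by case: Fcc.
  exact: compactly_contracting_shrinks.
- move=> /locally_contracting_compactly Fcc.
  apply: (shrinks_has_attractor Xg) => //; first by case: Fcc.
  exact: compactly_contracting_shrinks.
- exact: attractor_compact_dominating.
- apply: (compact_dominating_topologically Xh).
  exact: multimetric_gauge_separated D_multimetric X_canonical F_Edelstein.
Qed.
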